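(* Let $\mathcal{H}$ be a real Hilbert space, let $A,B,C:\mathcal{H}\rightrightarrows\mathcal{H}$ be set-valued operators and let $\alpha,\beta\in\mathbb{R}\setminus\{0\}$. Then: (i) $\mathcal{G}(A,B)=\mathcal{G}(A\circ B^{-1},\mathrm{id})$. (ii) $\mathcal{G}(\alpha A,\beta B)=(\alpha/\beta)\,\mathcal{G}(A,B)$. (iii) $\mathcal{G}(B,A)=(\mathcal{G}(A,B))^{-1}$. (iv) $\mathcal{G}(\mathrm{id},A)=(\mathcal{G}(A,\mathrm{id}))^{-1}=\mathcal{G}(A^{-1},\mathrm{id})$. (v) If either $\mathcal{G}(A,C)$ or $\mathcal{G}(B,C)$ satisfies the chord property, then $\mathcal{G}(A+B,C)\subseteq\mathcal{G}(A,C)+\mathcal{G}(B,C)$. (vi) If either $\mathcal{G}(B,A)$ or $\mathcal{G}(C,A)$ satisfies the chord property, then $\mathcal{G}(A,B+C)\subseteq\big(\mathcal{G}(A,B)^{-1}+\mathcal{G}(A,C)^{-1}\big)^{-1}$.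
   Context: Operators: for $A:\mathcal{H}\rightrightarrows\mathcal{H}$, $\operatorname{gph}A=\{(x,u):u\in A(x)\}$, $\operatorname{dom}A=\{x:A(x)\neq\emptyset\}$, $A^{-1}(u)=\{x:u\in A(x)\}$, $(A\circ B)(x)=\bigcup_{y\in B(x)}A(y)$; sums $A+B$ and multiples $\alpha A$ are pointwise (Minkowski). $\mathrm{id}$ is the identity operator. Extended complex plane: $\overline{\mathbb{C}}=\mathbb{C}\cup\{\infty\}$. For $S,T\subseteq\overline{\mathbb{C}}$, $S+T=\{s+t:s\in S\cap\mathbb{C},\,t\in T\cap\mathbb{C}\}\cup\{\infty:\infty\in S\text{ or }\infty\in T\}$ (so $\infty$ belongs to $S+T$ exactly when it belongs to $S$ or to $T$). For $\lambda\in\mathbb{C}\setminus\{0\}$, $\lambda S=\{\lambda s:s\in S\cap\mathbb{C}\}\cup\{\infty:\infty\in S\}$. $S^{-1}=\{(z^{-1})^*:z\in S\}$, where $^*$ is complex conjugation, with $0^{-1}=\infty$, $\infty^{-1}=0$ and $\infty^*=\infty$. A set $S\subseteq\overline{\mathbb{C}}$ satisfies the chord property if for every $z\in S\setminus\{\infty\}$, $\{\theta z+(1-\theta)z^*:\theta\in(0,1)\}\subseteq S$. Scaled relative graph of a pair: for $a,b\in\mathcal{H}$ with $b\neq0$ let $z_\pm(a,b)=\frac{\|a\|}{\|b\|}\exp(\pm i\angle(b,a))$ (a complex-conjugate pair), where $\angle(b,a)=\arccos\frac{\langle b,a\rangle}{\|b\|\|a\|}\in[0,\pi]$ if $a\neq0$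 and $b\ne 0$, and $\angle(b,a)=0$ otherwise. For $A,B:\mathcal{H}\rightrightarrows\mathcal{H}$, $\mathcal{G}(A,B)\subseteq\overline{\mathbb{C}}$ consists of all points $z_\pm(u_A-\bar u_A,u_B-\bar u_B)$ (both signs) with $x,\bar x\in\operatorname{dom}A\cap\operatorname{dom}B$, $u_A\in A(x)$, $\bar u_A\in A(\bar x)$, $u_B\in B(x)$, $\bar u_B\in B(\bar x)$ and $u_B\neq\bar u_B$; additionally $\infty\in\mathcal{G}(A,B)$ if and only if there exist $(x,u_A),(\bar x,\bar u_A)\in\operatorname{gph}A$ and $(x,u_B),(\bar x,\bar u_B)\in\operatorname{gph}B$ (possibly $x=\bar x$) with $u_B=\bar u_B$ and $u_A\neq\bar u_A$. *)

(* Defs.v *)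
From HB Require Import structures.
From mathcomp Require Import all_boot all_order all_algebra.
From mathcomp Require Import all_classical all_reals all_analysis.
From mathcomp Require Import complex.
Set Implicit Arguments.
Unset Strict Implicit.
Unset Printing Implicit Defensive.
Import Order.TTheory GRing.Theory Num.Theory.
Import numFieldNormedType.Exports.
Local Open Scope classical_set_scope.
Local Open Scope ring_scope.
Local Open Scope complex_scope.

Section SetValuedOperators.
Variables (R : realType) (H : completeNormedModType R).
Implicit Types A B : H -> set H.

Definition gph A : set (H * H) := [set p | A p.1 p.2].
Definition dom A : set H := [set x | A x !=set0].
Definition op_id : H -> set H := fun x => [set x].
Definition op_inv A : H -> set H := fun u => [set x | A x u].
Definition op_comp A B : H -> set H := fun x => \bigcup_(y in B x) A y.
Definition op_add A B : H -> set H :=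
  fun x => [set u + v | u in A x & v in B x].
Definition op_scale (k : R) A : H -> set H := fun x => [set k *: u | u in A x].

End SetValuedOperators.

Section ExtendedComplexPlane.
Variable R : realType.

(* [None] is the point at infinity; the topology of the plane plays no role. *)
Definition extC : Type := option R[i].
Implicit Types (S T : set extC) (z : extC).

Definition ext_add S T : set extC :=
  [set Some (s + t) | s in Some @^-1` S & t in Some @^-1` T]
  `|` [set z | z = None /\ (S None \/ T None)].

Definition ext_scale (k : R[i]) S : set extC :=
  [set Some (k * s) | s in Some @^-1` S] `|` [set z | z = None /\ S None].

Definition ext_conj_inv z : extC :=
  if z is Some w then if w == 0 then None else Some (conjc w^-1) else Some 0.

Definition ext_inv S : set extC := ext_conj_inv @` S.

Definition chord_property S : Prop :=
  forall w : R[i], S (Some w) -> forall t : R, 0 < t < 1 ->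
    S (Some (t%:C * w + (1 - t)%:C * conjc w)).

(* [expi t] is exp(i t), by Euler's formula. *)
Definition expi (t : R) : R[i] := cos t +i* sin t.

End ExtendedComplexPlane.
Arguments extC : clear implicits.

Section ScaledRelativeGraph.
Variables (R : realType) (H : completeNormedModType R).
Variable dot : {dot H for idfun}.
Implicit Types (A B : H -> set H) (a b : H).

(* A real Hilbert space is a complete normed module [H] with an inner product
   [dot] (symmetric bilinear positive definite) that induces its norm. *)
Definition dot_induces_norm : Prop := forall x : H, dot x x = `|x| ^+ 2.

Definition angle b a : R :=
  if (a != 0) && (b != 0) then acos (dot b a / (`|b| * `|a|)) else 0.

Definition zplus a b : R[i] := (`|a| / `|b|)%:C * expi (angle b a).
Definition zminus a b : R[i] := (`|a| / `|b|)%:C * expi (- angle b a).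

Definition SRG A B : set (extC R) :=
  [set z | exists x x' uA uA' uB uB' : H,
     [/\ (dom A `&` dom B) x /\ (dom A `&` dom B) x',
         A x uA /\ A x' uA',
         B x uB /\ B x' uB',
         uB <> uB' &
         z = Some (zplus (uA - uA') (uB - uB')) \/
         z = Some (zminus (uA - uA') (uB - uB'))]]
  `|`
  [set z | z = None /\ exists x x' uA uA' uB uB' : H,
     [/\ gph A (x, uA) /\ gph A (x', uA'),
         gph B (x, uB) /\ gph B (x', uB'),
         uB = uB' & uA <> uA']].

End ScaledRelativeGraph.

(* Main.v *)
Require Import Defs.
From HB Require Import structures.
From mathcomp Require Import all_boot all_order all_algebra.
From mathcomp Require Import all_classical all_reals all_analysis.
From mathcomp Require Import complex.
From mathcomp Require Import ring lra.
Set Implicit Arguments.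
Unset Strict Implicit.
Unset Printing Implicit Defensive.
Import Order.TTheory GRing.Theory Num.Theory.
Import numFieldNormedType.Exports.
Local Open Scope classical_set_scope.
Local Open Scope ring_scope.
Local Open Scope complex_scope.

(** The points z_±(a, b) are exactly the complex numbers w with
    [Re w * |b|^2 = <a, b>] and [|w|^2 * |b|^2 = |a|^2]; given the first
    equation, the second says that [|Im w| * |b|] is the norm of the component
    of [a] orthogonal to [b].  The condition is polynomial and nearly symmetric
    in [a] and [b], which gives the composition, scaling and inversion rules.
    For sums, real parts add exactly, and imaginary parts satisfy the triangle
    inequality; the chord property supplies the intermediate imaginary part
    that is needed.  The sum rule in the second argument is the one in the
    first argument conjugated by the inversion. *)

Local Notation Re := (@complex.Re _).
Local Notation Im := (@complex.Im _).

Section InnerProduct.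
Variables (R : realType) (H : completeNormedModType R).
Variable dot : {dot H for idfun}.
Hypothesis dot_norm : dot_induces_norm dot.
Implicit Types a b c : H.

(** * Bilinearity and orthogonal components *)

Lemma dotC a b : dot a b = dot b a.
Proof. by rewrite hermC /= expr0 mul1r. Qed.

Lemma dotDl a b c : dot (a + b) c = dot a c + dot b c.
Proof. exact: linearDl. Qed.

Lemma dotZl (k : R) a b : dot (k *: a) b = k * dot a b.
Proof. exact: linearZl_LR. Qed.

Lemma dotZr (k : R) a b : dot a (k *: b) = k * dot a b.
Proof. by rewrite dotC dotZl dotC. Qed.

Definition perp a b : H := a - (dot a b / `|b| ^+ 2) *: b.

Lemma perpD a b c : perp (a + b) c = perp a c + perp b c.
Proof. by rewrite /perp dotDl mulrDl scalerDl opprD addrACA. Qed.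

Lemma sqr_norm_perp a b : b != 0 ->
  `|perp a b| ^+ 2 = `|a| ^+ 2 - dot a b ^+ 2 / `|b| ^+ 2.
Proof.
move=> b0; have nb : `|b| != 0 by rewrite normr_eq0.
rewrite -dot_norm /perp -scaleNr dotDl [dot a _]dotC dotDl.
rewrite [dot _ (a + _)]dotC dotDl !dotZl !dotZr (dotC b a) !dot_norm.
by field.
Qed.

(** The squared norm of [perp a b] is nonnegative. The bound keeps the argument of [acos] in [angle]
    within its domain. *)
Lemma CauchySchwarz_sqr a b : dot a b ^+ 2 <= `|a| ^+ 2 * `|b| ^+ 2.
Proof.
have [->|b0] := eqVneq b 0.
  by rewrite -(scale0r (0 : H)) dotZr mul0r expr0n mulr_ge0 ?sqr_ge0.
have nb : 0 < `|b| ^+ 2 by rewrite exprn_gt0 ?normr_gt0.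
have := sqr_ge0 `|perp a b|.
by rewrite (sqr_norm_perp _ b0) subr_ge0 ler_pdivrMr.
Qed.

(** * Points of the graph as solutions of two real equations *)

Definition srg_point a b (w : R[i]) : Prop :=
  Re w * `|b| ^+ 2 = dot a b /\
  (Re w ^+ 2 + Im w ^+ 2) * `|b| ^+ 2 = `|a| ^+ 2.

(** Pythagoras: the part of [a] along [b] has squared norm [Re w ^+ 2 * |b| ^+ 2]. Since [perp] is
    additive in [a], this form gives access to the triangle inequality. *)
Lemma srg_point_perp a b w : b != 0 ->
  srg_point a b w <->
  Re w * `|b| ^+ 2 = dot a b /\ `|Im w| * `|b| = `|perp a b|.
Proof.
move=> b0; have nb : `|b| != 0 by rewrite normr_eq0.
have E : Re w * `|b| ^+ 2 = dot a b ->
    `|perp a b| ^+ 2 = `|a| ^+ 2 - Re w ^+ 2 * `|b| ^+ 2.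
  by move=> h; rewrite sqr_norm_perp// -h; field.
split=> -[h1 h2]; split=> //.
  apply/eqP; rewrite -(@eqrXn2 _ 2) ?mulr_ge0//; apply/eqP.
  by rewrite (E h1) -h2 exprMn real_normK ?num_real//; ring.
have := E h1; rewrite -h2 exprMn real_normK ?num_real// => h3.
by rewrite mulrDl h3; ring.
Qed.

Lemma srg_point_conjc a b w : srg_point a b w <-> srg_point a b (conjc w).
Proof. by case: w => p q; rewrite /srg_point /= sqrrN. Qed.

Lemma srg_point_zplus a b : b != 0 -> srg_point a b (zplus dot a b).
Proof.
move=> b0; have nb : `|b| != 0 by rewrite normr_eq0.
rewrite /srg_point /zplus /expi /angle b0 andbT /=.
(* For [a = 0] the angle takes its default value 0, which is harmless because the modulus
   vanishes. *)
have [->|a0] /= := eqVneq a 0.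
  rewrite -(scale0r (0 : H)) dotZl scale0r normr0 !mul0r subrr addr0.
  by rewrite expr0n addr0 !mul0r.
have na : `|a| != 0 by rewrite normr_eq0.
have pa : 0 < `|a| by rewrite normr_gt0.
have pb : 0 < `|b| by rewrite normr_gt0.
set t := dot b a / _.
have t1 : -1 <= t <= 1.
  rewrite -ler_norml -(@expr_le1 _ 2)// real_normK ?num_real//.
  rewrite /t exprMn exprVn ler_pdivrMr ?exprn_gt0 ?mulr_gt0// mul1r exprMn.
  exact: CauchySchwarz_sqr.
rewrite acosK ?in_itv//= sin_acos//.
have t2 : 0 <= 1 - t ^+ 2.
  by rewrite subr_ge0 -real_normK ?num_real// expr_le1// ler_norml.
split; first by rewrite /t (dotC b a); field; rewrite na.
rewrite !mul0r subr0 addr0 exprMn [X in _ + X]exprMn sqr_sqrtr//.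
by field.
Qed.

Lemma zminusE a b : zminus dot a b = conjc (zplus dot a b).
Proof.
rewrite /zminus /zplus /expi /= cosN sinN; congr Complex; ring.
Qed.

(** The two equations fix [Re w] and the square of [Im w], hence [w] up to conjugation. *)
Lemma srg_point_uniq a b w : b != 0 -> srg_point a b w ->
  w = zplus dot a b \/ w = zminus dot a b.
Proof.
move=> b0; rewrite zminusE; have := srg_point_zplus a b0.
case: (zplus dot a b) => p q; case: w => r s.
rewrite /srg_point /= => -[h1 h2] [h3 h4].
have nb : `|b| ^+ 2 != 0 by rewrite expf_neq0// normr_eq0.
have {h1 h3} rp : r = p by apply: (mulIf nb); rewrite h1 h3.
subst r.
have /eqP : s ^+ 2 = q ^+ 2.
  by apply: (addrI (p ^+ 2)); apply: (mulIf nb); rewrite h2 h4.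
by rewrite eqf_sqr => /orP[] /eqP ->; [left|right].
Qed.

(* Only [a <> 0] over [b = 0] gives infinity: the pair (0, 0) gives no point. *)
Definition ext_srg_point a b (z : extC R) : Prop :=
  if z is Some w then b != 0 /\ srg_point a b w else b = 0 /\ a != 0.

Lemma SRGP (A B : H -> set H) z : SRG dot A B z <->
  exists x x' uA uA' uB uB', [/\ A x uA /\ A x' uA', B x uB /\ B x' uB' &
    ext_srg_point (uA - uA') (uB - uB') z].
Proof.
split.
  move=> [[x [x' [a [a' [b [b' [_ hA hB /eqP bb h]]]]]]]|].
    exists x, x', a, a', b, b'; split=> //.
    move: bb; rewrite -subr_eq0 => bb.
    case: h => ->; split=> //; first exact: srg_point_zplus.
    by rewrite zminusE -srg_point_conjc; exact: srg_point_zplus.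
  move=> [->] [x [x' [a [a' [b [b' [hA hB bb /eqP aa]]]]]]].
  exists x, x', a, a', b, b'; split=> //.
  by rewrite /ext_srg_point subr_eq0 bb subrr.
move=> [x [x' [a [a' [b [b' [[Ax Ax'] [Bx Bx']]]]]]]]; case: z => [w|] /=.
  move=> [bb h]; left; exists x, x', a, a', b, b'; split=> //.
  - by do !split; [exists a|exists b|exists a'|exists b'].
  - by move=> e; rewrite e subrr eqxx in bb.
  - by case: (srg_point_uniq bb h) => ->; [left|right].
move=> [/eqP bb]; rewrite subr_eq0 => /eqP aa; right; split=> //.
exists x, x', a, a', b, b'; split=> //.
by apply/eqP; rewrite -subr_eq0.
Qed.

(** * Inversion, scaling and addition in the extended plane *)

Lemma ext_conj_invK : involutive (@ext_conj_inv R).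
Proof.
case=> [w|] /=; last by rewrite eqxx.
have [->|w0] //= := eqVneq w 0.
by rewrite conjc_eq0 invr_eq0 (negbTE w0) -conjc_inv invrK conjcK.
Qed.

Lemma ext_invE (S : set (extC R)) z : ext_inv S z <-> S (ext_conj_inv z).
Proof.
split=> [[s Ss <-]|h]; first by rewrite ext_conj_invK.
by exists (ext_conj_inv z) => //; rewrite ext_conj_invK.
Qed.

(** For [w != 0] the conjugate inverse is [w / |w|^2], and [|a|^2 = |w|^2 |b|^2] turns each equation
    for the pair [a], [b] into the one for [b], [a]. For finite points, [w = 0] forces [a = 0],
    which gives infinity after the swap. *)
Lemma ext_srg_point_inv a b z :
  ext_srg_point a b z -> ext_srg_point b a (ext_conj_inv z).
Proof.
case: z => [w|] /=; last first.
  move=> [-> a0]; split=> //; split=> /=.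
    by rewrite mul0r -(scale0r (0 : H)) dotZl mul0r.
  by rewrite normr0 expr0n addr0 mul0r.
move=> [b0 [h1 h2]].
have nb : `|b| ^+ 2 != 0 by rewrite expf_neq0// normr_eq0.
have w2 : (w == 0) = (Re w ^+ 2 + Im w ^+ 2 == 0).
  by case: w {h1 h2} => p q; rewrite eq_complex /= paddr_eq0 ?sqr_ge0// !sqrf_eq0.
case: ifPn; rewrite w2 => w0.
  split=> //; apply/eqP; rewrite -normr_eq0 -sqrf_eq0 -h2.
  by rewrite (eqP w0) mul0r.
have a0 : a != 0.
  by rewrite -normr_eq0 -sqrf_eq0 -h2 mulf_neq0.
split=> //; split; rewrite -h2.
  rewrite dotC -h1; case: w w0 {w2 h1 h2} => p q /= w0.
  by field.
case: w w0 {w2 h1 h2} => p q /= w0.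
by field.
Qed.

Lemma ext_srg_point_scale (k l : R) a b z : k != 0 -> l != 0 ->
  ext_srg_point a b z ->
  ext_srg_point (k *: a) (l *: b) (omap ( *%R (k / l)%:C) z).
Proof.
move=> k0 l0; case: z => [w|] /=; last first.
  by move=> [-> a0]; rewrite scaler0 scaler_eq0 negb_or k0.
move=> [b0 [h1 h2]]; rewrite scaler_eq0 negb_or l0; split=> //.
case: w h1 h2 => p q /= h1 h2; split=> /=.
  rewrite dotZl dotZr -h1 normrZ exprMn real_normK ?num_real//.
  by field.
rewrite !normrZ !exprMn !real_normK ?num_real// -h2.
by field.
Qed.

Lemma ext_scaleE (k : R[i]) (S : set (extC R)) :
  ext_scale k S = omap ( *%R k) @` S.
Proof.
apply/seteqP; split=> [z [[w Sw <-]|[-> SN]]|z [[w|] Sw <-]].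
- by exists (Some w).
- by exists None.
- by left; exists w.
- by right.
Qed.

Lemma ext_addP (S T : set (extC R)) z : ext_add S T z <->
  (exists s t, [/\ S (Some s), T (Some t) & z = Some (s + t)]) \/
  (z = None /\ (S None \/ T None)).
Proof.
split=> [[[s Ss [t Tt <-]]|//]|[[s [t [Ss Tt ->]]]|]].
- by left; exists s, t.
- by right.
- by left; exists s => //; exists t.
- by right.
Qed.

Lemma ext_addC (S T : set (extC R)) : ext_add S T = ext_add T S.
Proof.
suff sub (U V : set (extC R)) : ext_add U V `<=` ext_add V U by apply/seteqP; split.
move=> z /ext_addP[[s [t [Us Vt ->]]]|[-> h]]; apply/ext_addP.
  by left; exists t, s; rewrite addrC.
by right; split=> //; case: h; [right|left].
Qed.

Lemma op_addC (A B : H -> set H) : op_add A B = op_add B A.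
Proof.
suff sub (U V : H -> set H) x : op_add U V x `<=` op_add V U x.
  by apply/funext => x; apply/seteqP; split.
by move=> _ [u Uu [v Vv <-]]; exists v => //; exists u => //; rewrite addrC.
Qed.

(** * The chord property and the sum rule *)

Lemma chord_property_Im (S : set (extC R)) (p q s : R) : chord_property S ->
  S (Some (p +i* q)) -> S (Some (p -i* q)) -> `|s| <= `|q| ->
  S (Some (p +i* s)).
Proof.
move=> chord Sq SNq sq.
have [q0|q0] := eqVneq q 0.
  by move: sq; rewrite q0 normr0 normr_le0 => /eqP ->; rewrite q0 in Sq.
(* The chord is open, so its endpoints come from the two membership hypotheses instead. *)
have [sqE|sq_neq] := eqVneq `|s| `|q|.
  by move/eqP: sqE; rewrite eqr_norm2 => /orP[] /eqP ->.
have {sq sq_neq} sq : `|s / q| < 1.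
  by rewrite normf_div ltr_pdivrMr ?normr_gt0// mul1r lt_neqAle sq_neq.
(* This parameter [t] solves [t * q - (1 - t) * q = s]. *)
have := chord _ Sq ((1 + s / q) / 2).
move: sq; rewrite ltr_norml => /andP[s1 s2].
have -> : 0 < (1 + s / q) / 2 < 1 by apply/andP; split; lra.
move=> /(_ isT) /=.
by congr (S (Some _)); congr Complex; field.
Qed.

Lemma SRG_conjc (A B : H -> set H) w :
  SRG dot A B (Some w) -> SRG dot A B (Some (conjc w)).
Proof.
move=> /SRGP[x [x' [a [a' [b [b' [hA hB [bb h]]]]]]]]; apply/SRGP.
exists x, x', a, a', b, b'; split=> //; split=> //.
by rewrite -srg_point_conjc.
Qed.

(* The triangle inequality for the components of [a] and [b] orthogonal to [c]
   says that [Im w] differs from one of [+-Im w2] by at most [|Im w1|]. *)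
Lemma srg_point_add a b c w : c != 0 -> srg_point (a + b) c w ->
  exists w1 w2 s, [/\ srg_point a c w1, srg_point b c w2,
    `|s| <= `|Im w1| & w = (Re w1 +i* s) + w2].
Proof.
move=> c0 hw.
have nc : 0 < `|c| by rewrite normr_gt0.
have [hw1 hw2] := (srg_point_perp (a + b) w c0).1 hw.
set w1 := zplus dot a c; have h1 := srg_point_zplus a c0.
have [h11 h12] := (srg_point_perp a w1 c0).1 h1.
(* Of the two conjugate choices for [w2], take one whose imaginary part does not have the sign
   opposite to that of [Im w]; then the distance of the imaginary parts is the distance of their
   absolute values. *)
wlog [w2 h2 sgn] : / exists2 w2, srg_point b c w2 & 0 <= Im w * Im w2.
  apply; set w2 := zplus dot b c; have h2 := srg_point_zplus b c0.
  have [?|lt0] := leP 0 (Im w * Im w2); first by exists w2.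
  exists (conjc w2); first by rewrite -srg_point_conjc.
  by move: lt0; case: (w2) => p q /= lt0; rewrite mulrN oppr_ge0 ltW.
have [h21 h22] := (srg_point_perp b w2 c0).1 h2.
exists w1, w2, (Im w - Im w2); split=> //; last first.
  have : Re w = Re w1 + Re w2.
    apply: (mulIf (lt0r_neq0 (exprn_gt0 2 nc))).
    by rewrite hw1 mulrDl h11 h21 dotDl.
  case: w w1 w2 {hw hw1 hw2 h1 h11 h12 h2 h21 h22 sgn} => [p q] [p1 q1] [p2 q2].
  by move=> /= ->; congr Complex; ring.
have le1 : `|Im w| <= `|Im w1| + `|Im w2|.
  by rewrite -(ler_pM2r nc) mulrDl hw2 h12 h22 perpD ler_normD.
have le2 : `|Im w2| <= `|Im w| + `|Im w1|.
  rewrite -(ler_pM2r nc) mulrDl hw2 h12 h22.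
  have -> : perp b c = perp (a + b) c - perp a c by rewrite perpD addrC addKr.
  exact: ler_normB.
have -> : `|Im w - Im w2| = `| `|Im w| - `|Im w2| |.
  move: sgn; case: (ger0P (Im w)) => i1; case: (ger0P (Im w2)) => i2 sgn //.
  - have -> : Im w = 0 by nra.
    by rewrite !sub0r !normrN.
  - have -> : Im w2 = 0 by nra.
    by rewrite !subr0 normrN.
  - by rewrite -opprD normrN.
by rewrite ler_norml; apply/andP; split; lra.
Qed.

Lemma SRG_add (A B C : H -> set H) : chord_property (SRG dot A C) ->
  SRG dot (op_add A B) C `<=` ext_add (SRG dot A C) (SRG dot B C).
Proof.
move=> chord z /SRGP[x [x' [_ [_ [c [c' [[[a Aa [b Bb <-]] [a' Aa' [b' Bb' <-]]]
  [Cc Cc'] h]]]]]]]; apply/ext_addP.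
move: h; rewrite opprD addrACA.
have inA y : ext_srg_point (a - a') (c - c') y -> SRG dot A C y.
  by move=> hy; apply/SRGP; exists x, x', a, a', c, c'.
have inB y : ext_srg_point (b - b') (c - c') y -> SRG dot B C y.
  by move=> hy; apply/SRGP; exists x, x', b, b', c, c'.
case: z => [w|] [c0].
  move=> /(srg_point_add c0)[[p q] [w2 [s [h1 h2 hs ->]]]].
  left; exists (p +i* s), w2; split=> //; last exact: inB.
  have Sw : SRG dot A C (Some (p +i* q)) by exact: inA.
  exact: (chord_property_Im chord Sw (SRG_conjc Sw) hs).
move=> ab; right; split=> //.
(* At infinity the two differences have a nonzero sum, so at least one of them is nonzero. *)
have [a0|a0] := eqVneq (a - a') 0; last by left; exact: inA.
by right; apply: inB; split=> //; move: ab; rewrite a0 add0r.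
Qed.

Lemma SRG_add_chord (A B C : H -> set H) :
  chord_property (SRG dot A C) \/ chord_property (SRG dot B C) ->
  SRG dot (op_add A B) C `<=` ext_add (SRG dot A C) (SRG dot B C).
Proof.
by case=> h; [|rewrite op_addC ext_addC]; exact: SRG_add.
Qed.

(** * Swap, composition and scaling rules *)

Lemma SRG_swap (A B : H -> set H) : SRG dot B A = ext_inv (SRG dot A B).
Proof.
(* Inversion is an involution, so one inclusion, for all pairs of operators, yields the other. *)
suff sub (U V : H -> set H) : ext_inv (SRG dot U V) `<=` SRG dot V U.
  by apply/seteqP; split=> [z h|]; [apply/ext_invE/sub/ext_invE|exact: sub];
    rewrite ?ext_conj_invK.
move=> _ [z /SRGP[x [x' [a [a' [b [b' [hA hB h]]]]]]] <-]; apply/SRGP.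
by exists x, x', b, b', a, a'; split=> //; exact: ext_srg_point_inv.
Qed.

(** The graph of [op_comp A (op_inv B)] consists of the pairs of a value of [B] and a value of [A]
    at a common point. *)
Lemma SRG_comp_inv (A B : H -> set H) :
  SRG dot A B = SRG dot (op_comp A (op_inv B)) (@op_id R H).
Proof.
apply/seteqP; split=> z /SRGP.
  move=> [x [x' [a [a' [b [b' [[Aa Aa'] [Bb Bb'] h]]]]]]]; apply/SRGP.
  by exists b, b', a, a', b, b'; split=> //; split; [exists x|exists x'].
move=> [b [b' [a [a' [_ [_ [[[x Bx Ax] [x' Bx' Ax']] [-> ->] h]]]]]]].
by apply/SRGP; exists x, x', a, a', b, b'.
Qed.

Lemma SRG_scale (A B : H -> set H) (k l : R) : k != 0 -> l != 0 ->
  SRG dot (op_scale k A) (op_scale l B) = ext_scale (k / l)%:C (SRG dot A B).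
Proof.
move=> k0 l0; rewrite ext_scaleE; apply/seteqP; split=> z.
  move=> /SRGP[x [x' [_ [_ [_ [_ [[[a Aa <-] [a' Aa' <-]]
    [[b Bb <-] [b' Bb' <-]] h]]]]]]].
  (* The preimage of [z] comes from undoing both scalings, with factors [k^-1] and [l^-1]. *)
  exists (omap ( *%R (k^-1 / l^-1)%:C) z).
    apply/SRGP; exists x, x', a, a', b, b'; split=> //.
    rewrite -[a - a'](scalerK k0) -[b - b'](scalerK l0).
    by apply: ext_srg_point_scale; rewrite ?invr_eq0// !scalerBr.
  case: z {h} => [w|//] /=; congr Some.
  rewrite mulrA -rmorphM /= invrK [X in X%:C](_ : _ = 1) ?mul1r//.
  by field; rewrite k0.
move=> [y /SRGP[x [x' [a [a' [b [b' [[Aa Aa'] [Bb Bb'] h]]]]]]] <-].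
apply/SRGP; exists x, x', (k *: a), (k *: a'), (l *: b), (l *: b'); split.
- by split; [exists a|exists a'].
- by split; [exists b|exists b'].
- by rewrite -!scalerBr; exact: ext_srg_point_scale.
Qed.

Lemma op_comp_id (A : H -> set H) : op_comp (@op_id R H) A = A.
Proof.
apply/funext => x; apply/seteqP; split=> [y [z Az ->] //|y Ay].
by exists y.
Qed.

End InnerProduct.

Theorem mainTheorem1 (R : realType) (H : completeNormedModType R)
  (dot : {dot H for idfun}) (dot_norm : dot_induces_norm dot)
  (A B C : H -> set H) (alpha beta : R)
  (alpha_neq0 : alpha != 0) (beta_neq0 : beta != 0) :
  (* (i) *)
  SRG dot A B = SRG dot (op_comp A (op_inv B)) (@op_id R H) /\
  (* (ii) *)
  SRG dot (op_scale alpha A) (op_scale beta B)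
    = ext_scale (alpha / beta)%:C (SRG dot A B) /\
  (* (iii) *)
  SRG dot B A = ext_inv (SRG dot A B) /\
  (* (iv) *)
  (SRG dot (@op_id R H) A = ext_inv (SRG dot A (@op_id R H)) /\
   ext_inv (SRG dot A (@op_id R H)) = SRG dot (op_inv A) (@op_id R H)) /\
  (* (v) *)
  (chord_property (SRG dot A C) \/ chord_property (SRG dot B C) ->
   SRG dot (op_add A B) C `<=` ext_add (SRG dot A C) (SRG dot B C)) /\
  (* (vi) *)
  (chord_property (SRG dot B A) \/ chord_property (SRG dot C A) ->
   SRG dot A (op_add B C)
     `<=` ext_inv (ext_add (ext_inv (SRG dot A B)) (ext_inv (SRG dot A C)))).
Proof.
have swap := SRG_swap dot_norm.
split; first exact: SRG_comp_inv.
split; first exact: SRG_scale.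
split; first exact: swap.
split.
  split; first exact: swap.
  (* The inverse becomes [SRG dot (@op_id R H) A], to which the composition rule applies with the
     identity as first operator. *)
  by rewrite -swap (SRG_comp_inv dot_norm) op_comp_id.
split; first exact: SRG_add_chord.
move=> chord; rewrite -!swap (swap (op_add B C) A).
by apply: image_subset; exact: SRG_add_chord.
Qed.
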